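(* For integers $s\ge2r\ge2$, the $q$-Zeta numerator of the trapezoidal poset $T_{r,s}$ with rank $\rho(i,c)=c-i$ satisfies $$\mathbb{H}_{T_{r,s},\rho}(1,t)=\sum_{k=0}^{r-1}\binom{r-1}{k}\binom{s-r-1}{k}t^k.$$ In particular, this polynomial in $t$ is real-rooted with simple negative zeros. More precisely, writing $A=r-1$ and $B=s-r-1$, one has $$\mathbb{H}_{T_{r,s},\rho}(1,t)=(1-t)^A\,P_A^{(0,B-A)}\!\left(\frac{1+t}{1-t}\right),$$ where $P_A^{(\alpha,\beta)}$ is the Jacobi polynomial of degree $A$.
   Context: $q$-Zeta numerator: let $P$ be a finite graded poset with a unique maximum and rank function $\rho:P\to\{0,\dots,H\}$, where $H$ is the maximal rank. For $m\ge 0$ put $A_m(P,\rho;q)=\sum_{x_1\le\cdots\le x_m}q^{\rho(x_1)+\cdots+\rho(x_m)}$ (sum over weak chains in $P$; $A_0=1$). The numerator $\mathbb{H}_{P,\rho}(q,t)$ is the polynomial determined by $\sum_{m\ge 0}A_m(P,\rho;q)t^m=\mathbb{H}_{P,\rho}(q,t)/\prod_{a=0}^{H}(1-q^at)$. Trapezoidal poset: $T_{r,s}=\{(i,c):1\le i\le r,\ i\le c\le s-i\}$, ordered by $(i,c)\le(j,d)\iff i\ge j$ and $c\le d$. Jacobi polynomials have the standard normalization $P_n^{(\alpha,\beta)}(1)=\binom{n+\alpha}{n}$. *)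

(* Defs.v *)
From HB Require Import structures.
From mathcomp Require Import all_boot all_order all_algebra.
From mathcomp Require Import reals complex.
From mathcomp Require Import zify.

Set Implicit Arguments.
Unset Strict Implicit.
Unset Printing Implicit Defensive.

Import Order.TTheory GRing.Theory Num.Theory.
Local Open Scope ring_scope.

Section QZeta.
Context {d : Order.disp_t} {P : finPOrderType d}.
Implicit Type rho : P -> nat.

Definition covered_by (x y : P) : bool :=
  (x < y)%O && ~~ [exists z : P, (x < z < y)%O].

Definition is_rank_function rho : Prop :=
  (forall x : P, (forall y : P, ~~ (y < x)%O) -> rho x = 0%N) /\
  (forall x y : P, covered_by x y -> rho y = (rho x).+1).

Definition has_unique_maximum : Prop := exists x : P, forall y : P, (y <= x)%O.

(* A_m(P, rho; q); the variable of {poly int} is q. *)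
Definition qzeta_coef rho (m : nat) : {poly int} :=
  \sum_(x : m.-tuple P | sorted <=%O x) 'X^(\sum_(i < m) rho (tnth x i)).

(* prod_(0 <= a <= H) (1 - q^a t); the inner variable is q, the outer is t. *)
Definition qzeta_den (H : nat) : {poly {poly int}} :=
  \prod_(a < H.+1) (1 - ('X^a)%:P * 'X).

(* The identity of formal power series
     (sum_m A_m t^m) * prod_(0 <= a <= H) (1 - q^a t) = N(q, t),
   stated for the coefficient of each t^n.  The product is an invertible power
   series (its constant term is 1), so this says sum_m A_m t^m = N / prod. *)
Definition is_qzeta_numerator rho (N : {poly {poly int}}) : Prop :=
  let H := (\max_(x : P) rho x)%N in
  forall n : nat,
    \sum_(k < n.+1) (qzeta_den H)`_k * qzeta_coef rho (n - k) = N`_n.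

End QZeta.

Section Trapezoid.
Variables r s : nat.

(* T_{r,s}, as pairs p = (i, c).  The bounds of the ordinals are redundant, and
   the subtraction is not truncated where i <= c <= s - i with 1 <= i. *)
Definition trap : predArgType :=
  {p : 'I_r.+1 * 'I_s.+1 | (1 <= p.1)%N && (p.1 <= p.2 <= s - p.1)%N}.

HB.instance Definition _ := Finite.on trap.

Definition trap_i (x : trap) : nat := (val x).1.
Definition trap_c (x : trap) : nat := (val x).2.

Definition trap_le (x y : trap) : bool :=
  (trap_i y <= trap_i x)%N && (trap_c x <= trap_c y)%N.

Definition trap_rank (x : trap) : nat := (trap_c x - trap_i x)%N.

Fact trap_le_refl : reflexive trap_le.
Proof. by move=> x; rewrite /trap_le !leqnn. Qed.

Fact trap_le_anti : antisymmetric trap_le.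
Proof.
move=> x y; rewrite /trap_le => h; apply/val_inj.
rewrite [LHS]surjective_pairing [RHS]surjective_pairing.
by congr pair; apply/val_inj; move: h; rewrite /trap_i /trap_c /=; lia.
Qed.

Fact trap_le_trans : transitive trap_le.
Proof. move=> y x z; rewrite /trap_le; lia. Qed.

Fact trap_display : Order.disp_t. Proof. exact: (Order.Disp tt tt). Qed.

HB.instance Definition _ := Order.Le_isPOrder.Build trap_display trap
  trap_le_refl trap_le_anti trap_le_trans.

Lemma trap_leE (x y : trap) :
  (x <= y)%O = (trap_i y <= trap_i x)%N && (trap_c x <= trap_c y)%N.
Proof. by []. Qed.

Lemma trap_ltE (x y : trap) : (x < y)%O =
  (x <= y)%O && ((trap_i y < trap_i x) || (trap_c x < trap_c y))%N.
Proof.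
rewrite lt_neqAle; have [->|nxy] := eqVneq x y; first by rewrite !ltnn andbF.
rewrite /=; case: (boolP (x <= y)%O) => //= xy.
have : ~~ (y <= x)%O by apply: contra nxy => yx; rewrite eq_le xy yx.
move: xy; rewrite !trap_leE; lia.
Qed.

Lemma trapP (x : trap) :
  [/\ (1 <= trap_i x)%N, (trap_i x <= r)%N, (trap_i x <= trap_c x)%N
    & (trap_c x <= s - trap_i x)%N].
Proof.
have := valP x; rewrite /trap_i /trap_c.
have := ltn_ord (val x).1; split; lia.
Qed.

Lemma trap_mk (i c : nat) : (1 <= i <= r)%N -> (i <= c <= s - i)%N ->
  exists x : trap, trap_i x = i /\ trap_c x = c.
Proof.
move=> hi hc.
have li : (i < r.+1)%N by lia.
have lc : (c < s.+1)%N by lia.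
have h : (1 <= (Ordinal li, Ordinal lc).1)%N &&
  ((Ordinal li, Ordinal lc).1 <= (Ordinal li, Ordinal lc).2
    <= s - (Ordinal li, Ordinal lc).1)%N by rewrite /=; lia.
by exists (exist _ (Ordinal li, Ordinal lc) h).
Qed.

Lemma trap_is_rank_function : is_rank_function trap_rank.
Proof.
split=> [x xmin|x y /andP[xy /existsPn nz]].
  have [x1 x2 x3 x4] := trapP x; rewrite /trap_rank.
  have [->|nc] := eqVneq (trap_c x) (trap_i x); first by rewrite subnn.
  have [||y [yi yc]] := @trap_mk (trap_i x) (trap_c x).-1; try lia.
  by have := xmin y; rewrite trap_ltE trap_leE yi yc; lia.
have [x1 x2 x3 x4] := trapP x; have [y1 y2 y3 y4] := trapP y.
move: xy; rewrite trap_ltE trap_leE /trap_rank => xy.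
have [ixy|ixy] := ltnP (trap_i y) (trap_i x).
  have [||z [zi zc]] := @trap_mk (trap_i x).-1 (trap_c x); try lia.
  by have := nz z; rewrite !trap_ltE !trap_leE zi zc; lia.
have [||z [zi zc]] := @trap_mk (trap_i x) (trap_c x).+1; try lia.
by have := nz z; rewrite !trap_ltE !trap_leE zi zc; lia.
Qed.

Lemma trap_has_unique_maximum :
  (1 <= r)%N -> (2 * r <= s)%N -> @has_unique_maximum _ trap.
Proof.
move=> hr hs; have [||x [xi xc]] := @trap_mk 1 s.-1; try lia.
exists x => y; have [y1 y2 y3 y4] := trapP y.
rewrite trap_leE; lia.
Qed.

End Trapezoid.

(* (a)_k = a (a + 1) ... (a + k - 1) *)
Definition pochhammer (F : fieldType) (a : F) (k : nat) : F :=
  \prod_(j < k) (a + j%:R).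

(* P_n^(alpha, beta)(x) =
     ((alpha+1)_n / n!) 2F1(-n, n + alpha + beta + 1; alpha + 1; (1 - x) / 2),
   where the series stops at k = n because (-n)_k = 0 for k > n. *)
Definition jacobi (F : fieldType) (n : nat) (alpha beta : F) : {poly F} :=
  (pochhammer (alpha + 1) n / n`!%:R) *:
  \sum_(k < n.+1)
    (pochhammer (- n%:R) k * pochhammer (n%:R + alpha + beta + 1) k
       / (pochhammer (alpha + 1) k * k`!%:R)) *: (2%:R^-1 *: (1 - 'X)) ^+ k.

Lemma jacobi_at1 (F : numFieldType) (n a : nat) (beta : F) :
  (jacobi n a%:R beta).[1] = 'C(n + a, n)%:R.
Proof.
rewrite /jacobi hornerZ horner_sum big_ord_recl /= big1 => [|i _]; last first.
  by rewrite !(hornerE, horner_exp) subrr mulr0 expr0n /= mulr0.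
rewrite /pochhammer !big_ord0 !(hornerE, horner_exp) /= ?invr1 ?mulr1.
have n0 : n`!%:R != 0 :> F by rewrite pnatr_eq0 -lt0n fact_gt0.
apply: (mulIf n0); rewrite mulfVK // -natrM.
have a0 : a`!%:R != 0 :> F by rewrite pnatr_eq0 -lt0n fact_gt0.
apply: (mulIf a0); rewrite -natrM.
have -> : ('C(n + a, n) * n`! * a`!)%N = (n + a)`!.
  by rewrite -(bin_fact (leq_addr a n)) addKn mulnA.
elim: n {n0} => [|n IH]; first by rewrite big_ord0 mul1r add0n.
rewrite big_ord_recr /= mulrAC IH addSn factS mulnC natrM.
by congr (_ * _); rewrite -natr1 natrD addrAC [n%:R + _]addrC.
Qed.

(* Main.v *)
Require Import Defs.
From HB Require Import structures.
From mathcomp Require Import all_boot all_order all_algebra.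
From mathcomp Require Import reals complex.
From mathcomp Require Import zify ring.

Import Order.TTheory GRing.Theory Num.Theory.
Local Open Scope ring_scope.
Local Open Scope complex_scope.

(* Grouping chains by their underlying strict chain, sum_m A_m t^m is a sum of
   products of factors t q^(rho x) / (1 - q^(rho x) t) over elements of distinct
   ranks, so the numerator is a polynomial.  At q = 1, A_m counts multichains;
   those above a given element of T_{r,s} are counted by a 2 x 2 determinant of
   binomials (Lindstrom-Gessel-Viennot), and summing over the first element
   telescopes to C(m+A,m) C(m+B,m), whose generating function is
   h_A(t) / (1-t)^(A+B+1) with h_A(t) = sum_k C(A,k) C(B,k) t^k.

   The zeros come from recurrences in A for fixed B.  By the three-term one, the
   sign of Im(h_(A+1)(z) / h_A(z)) is that of Im z, so h_A has no nonreal zero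
   when A <= B; nonnegativity of the coefficients excludes zeros in [0, +oo);
   and by the two first-order ones a double zero of h_(A+1) would be a double
   zero of h_A.  The Jacobi form is a binomial expansion of (1 - t) + t E, with
   E the shift operator on sequences. *)

(** * Products of a polynomial with a formal power series *)

Section Convolution.
Context {K : comNzRingType}.
Implicit Types (p q : {poly K}) (f g : nat -> K).

(* The coefficient of t^n in p(t) * sum_m (f m) t^m. *)
Definition conv p f (n : nat) : K := \sum_(k < n.+1) p`_k * f (n - k)%N.

(** Coefficient n sees only the first n + 1 terms of the series, so truncation reduces [conv] to a
    polynomial product; [convM] takes associativity from there. *)
Lemma conv_trunc p f n L : (n < L)%N -> conv p f n = (p * \poly_(i < L) f i)`_n.
Proof.
move=> nL; rewrite coefM; apply: eq_bigr => k _.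
by rewrite coef_poly (leq_ltn_trans (leq_subr _ _) nL).
Qed.

Lemma conv_coef p q n : conv p (nth 0 q) n = (p * q)`_n.
Proof. by rewrite coefM. Qed.

Lemma eq_conv p f g n :
  (forall m, (m <= n)%N -> f m = g m) -> conv p f n = conv p g n.
Proof. by move=> fg; apply: eq_bigr => k _; rewrite fg ?leq_subr. Qed.

Lemma convM p q f n : conv (p * q) f n = conv p (conv q f) n.
Proof.
rewrite (conv_trunc _ _ _ _ (ltnSn n)) -mulrA coefM; apply: eq_bigr => k _.
by rewrite (conv_trunc _ _ _ n.+1) // ltnS leq_subr.
Qed.

Lemma convD p f g n : conv p (fun m => f m + g m) n = conv p f n + conv p g n.
Proof. by rewrite -big_split; apply: eq_bigr => k _; rewrite mulrDr. Qed.

Lemma conv_sum (I : finType) (P : pred I) p (f : I -> nat -> K) n :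
  conv p (fun m => \sum_(i | P i) f i m) n = \sum_(i | P i) conv p (f i) n.
Proof. by rewrite exchange_big; apply: eq_bigr => k _; rewrite mulr_sumr. Qed.

Lemma conv1 f n : conv 1 f n = f n.
Proof.
rewrite /conv big_ord_recl coef1 mul1r subn0 big1 ?addr0 // => k _.
by rewrite coef1 mul0r.
Qed.

Lemma convBl p q f n : conv (p - q) f n = conv p f n - conv q f n.
Proof.
by rewrite -sumrB; apply: eq_bigr => k _; rewrite coefB mulrBl.
Qed.

Lemma conv_cX c f n :
  conv (c%:P * 'X) f n = if n is m.+1 then c * f m else 0.
Proof.
have E k : (c%:P * 'X)`_k = c * (k == 1)%:R by rewrite coefCM coefX.
case: n => [|n]; first by rewrite /conv big_ord1 E mulr0 mul0r.
rewrite /conv !big_ord_recl big1 => [|k _]; rewrite !E /= ?mulr0 ?mul0r //.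
by rewrite /bump /= add1n subSS subn0 add0r mulr1 addr0.
Qed.

(** Leibniz rule for theta = t d/dt acting on p(t) * sum_m (f m) t^m. *)
Lemma conv_theta p f n :
  n%:R * conv p f n
    = conv ('X * p^`()) f n + conv p (fun m => m%:R * f m) n.
Proof.
rewrite /conv mulr_sumr -big_split; apply: eq_bigr => k _ /=.
have -> : ('X * p^`())`_k = k%:R * p`_k.
  by rewrite coefXM coef_deriv; case: (val k) => [|j] /=; rewrite ?mul0r // mulr_natl.
have -> : n%:R = k%:R + (n - k)%:R :> K by rewrite -natrD subnKC // -ltnS.
ring.
Qed.

Lemma convZr p c f n :
  conv p (fun m => c * f m) n = c * conv p f n.
Proof. by rewrite /conv mulr_sumr; apply: eq_bigr => k _; rewrite mulrCA. Qed.

Lemma convBr p f g n :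
  conv p (fun m => f m - g m) n = conv p f n - conv p g n.
Proof. by rewrite -sumrB; apply: eq_bigr => k _; rewrite mulrBr. Qed.

End Convolution.

(** * Weak chains as iterated sums *)

Lemma tuple_cons_sum (V : nmodType) (T : finType) (m : nat)
    (Q : pred (seq T)) (F : m.+1.-tuple T -> V) :
  \sum_(t : m.+1.-tuple T | Q t) F t
    = \sum_(y : T) \sum_(t : m.-tuple T | Q (y :: t)) F [tuple of y :: t].
Proof.
rewrite (reindex (fun yt : T * m.-tuple T => [tuple of yt.1 :: yt.2])) /=; last first.
  exists (fun t => (thead t, [tuple of behead t])) => [[y t] _|t _] /=.
    by congr pair; apply: val_inj.
  by apply: val_inj; case/tupleP: t => y t.
by rewrite -(pair_big_dep xpredT (fun y (t : m.-tuple T) => Q (y :: t))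
  (fun y t => F [tuple of y :: t])).
Qed.

Section ChainSums.
Context {d : Order.disp_t} {P : finPOrderType d} {K : comNzRingType}.
Variable w : P -> K.

(** The index counts the elements after [x], so these chains have m + 1 elements. *)
Fixpoint chain_sum (m : nat) (x : P) : K :=
  if m is m'.+1 then w x * \sum_(y : P | (x <= y)%O) chain_sum m' y else w x.

Lemma chain_sumE (m : nat) (x : P) :
  w x * \sum_(t : m.-tuple P | path <=%O x t) \prod_(i < m) w (tnth t i)
    = chain_sum m x.
Proof.
elim: m x => [|m IH] x /=.
  rewrite (big_pred1 [tuple]) => [|t]; first by rewrite big_ord0 mulr1.
  by rewrite [t]tuple0 /=; apply/esym/eqP/val_inj.
congr (_ * _); rewrite (tuple_cons_sum _ _ _ (path <=%O x)) /= [RHS]big_mkcond /=.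
apply: eq_bigr => y _; case: (x <= y)%O; last by rewrite big_pred0_eq.
rewrite -IH mulr_sumr; apply: eq_bigr => t _.
by rewrite big_ord_recl tnth0; under eq_bigr do rewrite tnthS.
Qed.

Lemma sorted_tuple_sum (m : nat) :
  \sum_(t : m.+1.-tuple P | sorted <=%O t) \prod_(i < m.+1) w (tnth t i)
    = \sum_(x : P) chain_sum m x.
Proof.
rewrite (tuple_cons_sum _ _ _ (sorted <=%O)); apply: eq_bigr => y _ /=.
rewrite -chain_sumE mulr_sumr; apply: eq_bigr => t _.
by rewrite big_ord_recl tnth0; under eq_bigr do rewrite tnthS.
Qed.

End ChainSums.

Lemma chain_sum_rmorph d (P : finPOrderType d) (K L : comNzRingType)
    (f : {rmorphism K -> L}) (w : P -> K) (m : nat) (x : P) :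
  f (chain_sum w m x) = chain_sum (f \o w) m x.
Proof.
elim: m x => [|m IH] x //=; rewrite rmorphM rmorph_sum; congr (_ * _).
by apply: eq_bigr => y _.
Qed.

(** * Rationality of the chain series *)

Section Numerator.
Context {d : Order.disp_t} {P : finPOrderType d}.
Variable rho : P -> nat.
Hypothesis rho_lt : forall x y : P, (x < y)%O -> (rho x < rho y)%N.

Let H := (\max_(x : P) rho x)%N.
Let w (x : P) : {poly int} := 'X^(rho x).

Lemma qzeta_coefS (m : nat) :
  qzeta_coef rho m.+1 = \sum_(x : P) chain_sum w m x.
Proof.
rewrite -sorted_tuple_sum; apply: eq_bigr => t _.
by rewrite (big_morph _ (exprD 'X) (expr0 'X)).
Qed.

Lemma qzeta_coef0 : qzeta_coef rho 0 = 1.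
Proof.
rewrite /qzeta_coef (big_pred1 [tuple]) => [|t]; first by rewrite big_ord0.
by rewrite [t]tuple0 /=; apply/esym/eqP/val_inj.
Qed.

(** Indexed by the full length, [x] included; hence 0 at length 0. *)
Let chains_from (x : P) (m : nat) := if m is m'.+1 then chain_sum w m' x else 0.

Let den (k : nat) : {poly {poly int}} := \prod_(k <= a < H.+1) (1 - ('X^a)%:P * 'X).

(* Chains x <= x_1 <= ... either stay at x, which gives the factor
   1 / (1 - q^(rho x) t), or move on to some y > x, whose rank is larger. *)
Lemma conv_chains_from (x : P) :
  exists p : {poly {poly int}}, forall n, conv (den (rho x)) (chains_from x) n = p`_n.
Proof.
have rhoH y : (rho y <= H)%N by exact: leq_bigmax.
have [N] := ubnP (H - rho x)%N; elim: N x => [//|N IH] x leN.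
have /fin_all_exists[p pE] (y : P) : exists p : {poly {poly int}},
    (x < y)%O -> forall n, conv (den (rho x).+1) (chains_from y) n = p`_n.
  case: (boolP (x < y)%O) => [xy|_]; last by exists 0.
  have rxy := rho_lt _ _ xy.
  have [|p pE] := IH y; first by have := rhoH y; lia.
  exists ((\prod_((rho x).+1 <= a < rho y) (1 - ('X^a)%:P * 'X)) * p) => _ n.
  have -> : den (rho x).+1
      = (\prod_((rho x).+1 <= a < rho y) (1 - ('X^a)%:P * 'X)) * den (rho y).
    by rewrite -big_cat_nat //= ltnW // ltnS.
  by rewrite convM -conv_coef; apply: eq_conv => m _; rewrite pE.
pose c := (w x)%:P * 'X.
(* If S_z is the series of chains from z, then S_x = c (1 + S_x + sum_(y > x) S_y), so (1 - c) S_x =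
   c + sum_(y > x) c S_y. *)
exists (den (rho x).+1 * c + \sum_(y : P | (x < y)%O) c * p y) => n.
have -> : den (rho x) = den (rho x).+1 * (1 - c).
  by rewrite /den big_ltn 1?mulrC // ltnS.
rewrite convM.
have E m : conv (1 - c) (chains_from x) m
    = c`_m + \sum_(y : P | (x < y)%O) conv c (chains_from y) m.
  rewrite convBl conv1 conv_cX coefCM coefX.
  under eq_bigr do rewrite conv_cX.
  case: m => [|[|m]]; rewrite /= ?mulr0 ?mulr1 ?add0r.
  - by rewrite oppr0 big1.
  - by rewrite subr0 big1 ?addr0.
  rewrite (bigD1 x) //= mulrDr addrAC subrr add0r mulr_sumr.
  by apply: eq_bigl => y; rewrite lt_neqAle eq_sym andbC.
rewrite (eq_conv _ _ (fun m => c`_m + \sum_(y | (x < y)%O) conv c (chains_from y) m)) //.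
rewrite convD conv_coef conv_sum coefD coef_sum; congr (_ + _).
apply: eq_bigr => y xy; rewrite -convM mulrC convM -conv_coef.
by apply: eq_conv => m _; rewrite pE.
Qed.

Lemma qzeta_numerator_exists : exists N, is_qzeta_numerator rho N.
Proof.
have denE : qzeta_den H = den 0 by rewrite /qzeta_den /den big_mkord.
have /fin_all_exists[p pE] (x : P) : exists p : {poly {poly int}},
    forall n, conv (den 0) (chains_from x) n = p`_n.
  have [p pE] := conv_chains_from x.
  exists ((\prod_(0 <= a < rho x) (1 - ('X^a)%:P * 'X)) * p) => n.
  have -> : den 0 = (\prod_(0 <= a < rho x) (1 - ('X^a)%:P * 'X)) * den (rho x).
    by rewrite -big_cat_nat //= ltnW // ltnS; exact: leq_bigmax.
  by rewrite convM -conv_coef; apply: eq_conv => m _; rewrite pE.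
(* The summand [den 0] comes from the empty chain, A_0 = 1. *)
exists (den 0 + \sum_x p x); rewrite /is_qzeta_numerator -/H denE /= => n.
rewrite -/(conv (den 0) (qzeta_coef rho) n).
transitivity (conv (den 0) (fun m => (1 : {poly {poly int}})`_m + \sum_x chains_from x m) n);
  last first.
  rewrite convD conv_coef mulr1 conv_sum coefD coef_sum.
  by under eq_bigr do rewrite pE.
apply: eq_conv; case=> [|m] _; first by rewrite qzeta_coef0 coef1 big1 ?addr0.
by rewrite qzeta_coefS coef1 add0r.
Qed.

End Numerator.

(** * Recurrences for sum_k C(a,k) C(b,k) t^k *)

Section Narayana.
Context {K : comNzRingType}.

Definition bin2_poly (a b : nat) : {poly K} :=
  \sum_(k < a.+1) ('C(a, k) * 'C(b, k))%:R *: 'X^k.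

Lemma coef_bin2_poly (a b k : nat) : (bin2_poly a b)`_k = ('C(a, k) * 'C(b, k))%:R.
Proof.
rewrite /bin2_poly -(poly_def a.+1 (fun k => ('C(a, k) * 'C(b, k))%:R)) coef_poly.
by case: ltnP => // ak; rewrite bin_small.
Qed.

Lemma bin2_poly0 (b : nat) : bin2_poly 0 b = 1.
Proof. by rewrite /bin2_poly big_ord1 !bin0 scale1r. Qed.

(** The subtraction is taken in [K], so k > n is covered too: both binomials vanish. *)
Lemma bin_stepR (n k : nat) :
  k.+1%:R * 'C(n, k.+1)%:R = (n%:R - k%:R) * 'C(n, k)%:R :> K.
Proof.
rewrite -natrM mul_bin_left natrM; case: (leqP k n) => [kn|nk].
  by rewrite natrB.
by rewrite bin_small // !mulr0.
Qed.

Lemma bin2_poly_up (a b : nat) : a.+1%:R *: bin2_poly a.+1 b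
  = 'X * (bin2_poly a b)^`() * (1 - 'X) + (b%:R *: 'X + a.+1%:R%:P) * bin2_poly a b.
Proof.
transitivity ('X * (bin2_poly a b)^`() - 'X * ('X * (bin2_poly a b)^`())
    + b%:R *: ('X * bin2_poly a b) + a.+1%:R *: bin2_poly a b); last first.
  by rewrite -!mul_polyC; ring.
apply/polyP=> k; rewrite !(coefD, coefB, coefN, coefZ, coefXM, coef_deriv, coef_bin2_poly).
case: k => [|k] /=; first by rewrite !bin0; ring.
have -> : (if k == 0 then 0 else ('C(a, k.-1.+1) * 'C(b, k.-1.+1))%:R *+ k.-1.+1)
    = k%:R * ('C(a, k) * 'C(b, k))%:R :> K.
  by case: k => [|k] /=; rewrite ?mul0r // mulr_natl.
rewrite binS -[_ *+ k.+1]mulr_natl !natrM natrD [k.+1%:R * _]mulrA bin_stepR.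
transitivity ((a%:R - k%:R) * 'C(a, k)%:R * 'C(b, k.+1)%:R
  + 'C(a, k)%:R * (k.+1%:R * 'C(b, k.+1)%:R)
  + a.+1%:R * ('C(a, k.+1)%:R * 'C(b, k.+1)%:R) : K).
  by ring.
by rewrite bin_stepR; ring.
Qed.

Lemma bin2_poly_down (a b : nat) :
  'X * (bin2_poly a.+1 b)^`() = a.+1%:R *: (bin2_poly a.+1 b - bin2_poly a b).
Proof.
apply/polyP=> k; rewrite coefXM coefZ coefB coef_deriv !coef_bin2_poly.
case: k => [|k] /=; first by rewrite !bin0; ring.
rewrite -[_ *+ k.+1]mulr_natl !natrM binS natrD.
transitivity ((k.+1%:R * 'C(a, k.+1)%:R + k.+1%:R * 'C(a, k)%:R) * 'C(b, k.+1)%:R : K).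
  by ring.
by rewrite bin_stepR -[a.+1]addn1 natrD; ring.
Qed.

(** [bin2_poly_down] eliminates the derivative from [bin2_poly_up]. *)
Lemma bin2_poly_three_term (a b : nat) : a.+2%:R *: bin2_poly a.+2 b
  = ((b%:R - a.+1%:R) *: 'X + (2 * a + 3)%:R%:P) * bin2_poly a.+1 b
    - a.+1%:R *: ((1 - 'X) * bin2_poly a b).
Proof.
by rewrite bin2_poly_up bin2_poly_down -!mul_polyC; ring.
Qed.

End Narayana.

(** * Reality, sign and simplicity of the zeros *)

(* A double root away from 0 and 1 would pass from bin2_poly a.+1 b to bin2_poly a b. *)
Lemma bin2_poly_deriv_neq0 (K : numFieldType) (a b : nat) (z : K) :
  z != 0 -> z != 1 -> root (bin2_poly a b) z -> (bin2_poly a b)^`().[z] != 0.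
Proof.
move=> z0 z1; elim: a => [|a IH] hz.
  by move: hz; rewrite bin2_poly0 rootE (hornerC 1) oner_eq0.
apply/eqP => dz; move: hz => /[dup] hz1 /rootP hz.
have a0 : a.+1%:R != 0 :> K by rewrite pnatr_eq0.
have := congr1 (horner^~ z) (bin2_poly_down (K := K) a b).
rewrite hornerM dz mulr0 hornerZ hornerD hornerN hz sub0r mulrN => /esym/eqP.
rewrite oppr_eq0 mulf_eq0 (negPf a0) /= => hz'.
have := congr1 (horner^~ z) (bin2_poly_up (K := K) a b).
rewrite hornerZ hz mulr0 hornerD [X in _ + X]hornerM (eqP hz') mulr0 addr0 !hornerM.
rewrite hornerX hornerD hornerN hornerX (hornerC 1) => /esym/eqP.
rewrite !mulf_eq0 (negPf z0) subr_eq0 [1 == z]eq_sym (negPf z1) /= orbF.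
by apply/negP; apply: IH.
Qed.

Lemma horner_bin2_poly_ge1 (F : realDomainType) (a b : nat) (x : F) :
  0 <= x -> 1 <= (bin2_poly a b).[x].
Proof.
move=> x0; rewrite /bin2_poly horner_sum big_ord_recl !bin0 scale1r hornerXn expr0.
rewrite lerDl; apply: sumr_ge0 => k _.
by rewrite hornerZ hornerXn mulr_ge0 ?exprn_ge0 ?ler0n.
Qed.

Lemma map_bin2_poly (K L : comNzRingType) (f : {rmorphism K -> L}) (a b : nat) :
  map_poly f (bin2_poly a b) = bin2_poly a b.
Proof. by apply/polyP => k; rewrite coef_map /= !coef_bin2_poly rmorph_nat. Qed.

(** In complex form, m h'' = (c z + w) h' - k (1 - z) h with z = x + i y. Dividing by h' expresses
    Im(h''/h') through c y and Im((1 - z) h/h'); dividing by (1 - z) h' expresses the other ratio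
    through (c + w) y / |1 - z|^2 and Im(h/h'). Inversion flips the sign of an imaginary part, so
    each hypothesis yields the opposite conclusion. Denominators are cleared by conjugates. *)
Lemma im_ratio_step (F : realDomainType) (c k m w x y u v u' v' u'' v'' : F) :
  y != 0 -> 0 <= c -> 0 < k -> 0 < m -> 0 <= w ->
  m * u'' = (c * x + w) * u' - c * y * v' - k * ((1 - x) * u + y * v) ->
  m * v'' = (c * x + w) * v' + c * y * u' - k * ((1 - x) * v - y * u) ->
  0 < y * (v' * u - u' * v) ->
  0 < y * ((u' * u + v' * v) * y + (v' * u - u' * v) * (1 - x)) ->
  0 < y * (v'' * u' - u'' * v') /\
  0 < y * ((u'' * u' + v'' * v') * y + (v'' * u' - u'' * v') * (1 - x)).
Proof.
move=> y0 c0 k0 m0 w0 eu ev h1 h2.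
have n0 : 0 <= y ^+ 2 * (u' ^+ 2 + v' ^+ 2) by rewrite mulr_ge0 ?addr_ge0 ?sqr_ge0.
have q2 : m * (y * (v'' * u' - u'' * v')) = c * (y ^+ 2 * (u' ^+ 2 + v' ^+ 2))
    + k * (y * ((u' * u + v' * v) * y + (v' * u - u' * v) * (1 - x))).
  transitivity (y * (m * v'' * u' - m * u'' * v')); first by ring.
  by rewrite eu ev; ring.
have w2 : m * (y * ((u'' * u' + v'' * v') * y + (v'' * u' - u'' * v') * (1 - x)))
    = (c + w) * (y ^+ 2 * (u' ^+ 2 + v' ^+ 2))
      + k * (y * (v' * u - u' * v) * ((1 - x) ^+ 2 + y ^+ 2)).
  transitivity (y * ((m * u'' * u' + m * v'' * v') * y
    + (m * v'' * u' - m * u'' * v') * (1 - x))); first by ring.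
  by rewrite eu ev; ring.
split; rewrite -(pmulr_rgt0 _ m0).
  by rewrite q2; apply: ltr_wpDl; [exact: mulr_ge0 | exact: mulr_gt0].
rewrite w2; apply: ltr_wpDl; first by apply: mulr_ge0 => //; exact: addr_ge0.
apply: mulr_gt0 => //; apply: mulr_gt0 => //.
by rewrite ltr_wpDl ?sqr_ge0 // lt0r sqrf_eq0 y0 sqr_ge0.
Qed.

(* For h_a = bin2_poly a b at z = x + i y, with y <> 0, the ratios h_(a+1) / h_a and
   h_(a+1) / ((1 - z) h_a) both have an imaginary part of the sign of y; this
   propagates along the three-term recurrence. *)
Lemma bin2_poly_ratio_im (R : rcfType) (a b : nat) (x y : R) : y != 0 -> (a < b)%N ->
  let: u +i* v := (bin2_poly a b).[x +i* y] in
  let: u' +i* v' := (bin2_poly a.+1 b).[x +i* y] in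
  let p := u' * u + v' * v in
  let q := v' * u - u' * v in
  0 < y * q /\ 0 < y * (p * y + q * (1 - x)).
Proof.
move=> y0; have yy : 0 < y * y by rewrite -expr2 lt0r sqrf_eq0 y0 sqr_ge0.
elim: a => [|a IH] ab.
  have -> : bin2_poly 1 b = 1 + b%:R *: 'X :> {poly R[i]}.
    by rewrite /bin2_poly big_ord_recl big_ord1 /= !bin0 binn bin1 !mul1n scale1r.
  rewrite bin2_poly0 hornerD hornerZ hornerX (hornerC 1).
  rewrite -(rmorph_nat (real_complex R)); simpc => /=.
  have b0 : 0 < b%:R :> R by rewrite ltr0n.
  rewrite !mulr0 !mulr1 subr0 addr0; split; first by rewrite mulrCA mulr_gt0.
  have -> : y * ((1 + b%:R * x) * y + b%:R * y * (1 - x)) = (1 + b%:R) * (y * y) by ring.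
  by rewrite mulr_gt0 ?addr_gt0.
have := IH (ltnW ab).
have := congr1 (horner^~ (x +i* y)) (bin2_poly_three_term (K := R[i]) a b).
rewrite !(hornerD, hornerN, hornerZ, hornerM, hornerX, hornerC).
case: (bin2_poly a b).[_] => u v; case: (bin2_poly a.+1 b).[_] => u' v'.
case: (bin2_poly a.+2 b).[_] => u'' v''.
rewrite -!(rmorph_nat (real_complex R)); simpc.
case=> e1 e2 /= [h1 h2].
apply: im_ratio_step y0 _ _ _ _ e1 e2 h1 h2; rewrite ?ltr0n ?ler0n //.
(* The coefficient c is b - (a + 1); this is where the bound on a enters. *)
by rewrite subr_ge0 ler_nat ltnW.
Qed.

Lemma bin2_poly_complex_root (R : rcfType) (a b : nat) (z : R[i]) : (a <= b)%N ->
  root (bin2_poly a b) z ->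
  exists x : R, [/\ z = x%:C, x < 0 & mup z (bin2_poly a b) = 1%N].
Proof.
case: z => x y ab hz; have y0 : y = 0.
  apply/eqP; apply: contraT => y0; case: a ab hz => [|a] ab.
    by rewrite bin2_poly0 rootE (hornerC 1) oner_eq0.
  (* At a zero of h_(a+1) the quantity q vanishes, against 0 < y * q. *)
  move=> /rootP hz; have := bin2_poly_ratio_im _ _ _ x y y0 ab; rewrite hz.
  case: (bin2_poly a b).[_] => u v /= [].
  by rewrite !mul0r subrr mulr0 ltxx.
rewrite {}y0 complexr0 in hz *; have x0 : x < 0.
  rewrite ltNge; apply/negP => x0; move: hz.
  rewrite -(map_bin2_poly _ _ (real_complex R)) /root horner_map /= fmorph_eq0 => /eqP hx.
  by have := horner_bin2_poly_ge1 _ a b _ x0; rewrite hx ler10.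
exists x; split=> //; apply/eqP; rewrite eqn_leq.
have n0 : bin2_poly a b != 0 :> {poly R[i]}.
  by apply/eqP => /(congr1 (coefp 0)) /eqP; rewrite /= coef_bin2_poly coef0 !bin0 oner_eq0.
have zx (t : R) : (x%:C == t%:C) = (x == t) by rewrite (inj_eq (@complexI R)).
(* Multiplicity at least 2 would make the derivative vanish at z. *)
rewrite -XsubC_dvd // dvdp_XsubCl hz andbT mup_leq //; apply/negP => /dvdpP[g gE].
have := bin2_poly_deriv_neq0 _ a b x%:C _ _ hz.
rewrite (zx 0) (zx 1) lt_eqF // lt_eqF ?(lt_trans x0) // => /(_ isT isT).
by rewrite gE expr2 !derivM !(hornerXsubC, hornerD, hornerM) subrr !(mul0r, mulr0, addr0) eqxx.
Qed.

(** * The Jacobi form *)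

(** With E the shift in n and Delta = E - 1 the step in k, this is ((1 - t) + t E)^A = (1 + t
    Delta)^A, expanded on both sides. *)
Lemma bernstein_differences (K : comNzRingType) (D : nat -> nat -> K) (t : K) :
  (forall k n, D k.+1 n = D k n.+1 - D k n) -> forall A k n,
  \sum_(j < A.+1) 'C(A, j)%:R * t ^+ j * (1 - t) ^+ (A - j) * D k (n + j)%N
    = \sum_(j < A.+1) 'C(A, j)%:R * t ^+ j * D (k + j)%N n.
Proof.
move=> DS; elim=> [|A IH] k n.
  by rewrite !big_ord1 !addn0 subnn expr0 !mulr1.
have pascal (F : nat -> K) : \sum_(j < A.+2) 'C(A.+1, j)%:R * F j
    = \sum_(j < A.+1) 'C(A, j)%:R * F j + \sum_(j < A.+1) 'C(A, j)%:R * F j.+1.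
  rewrite big_ord_recl [X in _ = X + _]big_ord_recl /= !bin0 -addrA; congr (_ + _).
  transitivity (\sum_(j < A.+1) ('C(A, j.+1)%:R * F j.+1 + 'C(A, j)%:R * F j.+1)).
    by apply: eq_bigr => j _; rewrite binS natrD mulrDl.
  by rewrite big_split /= big_ord_recr /= bin_small // mul0r addr0.
under eq_bigr do rewrite -!mulrA.
rewrite (pascal (fun j => t ^+ j * ((1 - t) ^+ (A.+1 - j) * D k (n + j)%N))).
under [RHS]eq_bigr do rewrite -!mulrA.
rewrite (pascal (fun j => t ^+ j * D (k + j)%N n)).
have -> : \sum_(j < A.+1)
    'C(A, j)%:R * (t ^+ j.+1 * ((1 - t) ^+ (A.+1 - j.+1) * D k (n + j.+1)%N))
  = t * \sum_(j < A.+1) 'C(A, j)%:R * t ^+ j * (1 - t) ^+ (A - j) * D k (n.+1 + j)%N.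
  rewrite mulr_sumr; apply: eq_bigr => j _; rewrite exprS subSS addnS addSn; ring.
have -> : \sum_(j < A.+1)
    'C(A, j)%:R * (t ^+ j * ((1 - t) ^+ (A.+1 - j) * D k (n + j)%N))
  = (1 - t) * \sum_(j < A.+1) 'C(A, j)%:R * t ^+ j * (1 - t) ^+ (A - j) * D k (n + j)%N.
  rewrite mulr_sumr; apply: eq_bigr => j _; rewrite subSn -1?ltnS // exprS; ring.
rewrite !IH !mulr_sumr -!big_split; apply: eq_bigr => j _ /=.
rewrite addnS DS exprS; ring.
Qed.

Lemma pochhammer_opp (F : fieldType) (A k : nat) : (k <= A)%N ->
  pochhammer (- A%:R : F) k = (-1) ^+ k * ('C(A, k) * k`!)%:R.
Proof.
rewrite bin_ffact /pochhammer; elim: k => [|k IH] kA; first by rewrite big_ord0 mul1r.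
rewrite big_ord_recr /= IH 1?ltnW // ffactnSr natrM natrB 1?ltnW // exprS; ring.
Qed.

Lemma pochhammer_succ (F : fieldType) (B k : nat) :
  pochhammer (B%:R + 1 : F) k = ('C(B + k, k) * k`!)%:R.
Proof.
rewrite bin_ffact /pochhammer; elim: k => [|k IH]; first by rewrite big_ord0.
rewrite big_ord_recr /= IH addnS ffactnS natrM /= -addn1 !natrD; ring.
Qed.

Lemma jacobi_bin2_poly (F : numFieldType) (A B : nat) (t : F) : t != 1 ->
  (1 - t) ^+ A * (jacobi A 0 (B%:R - A%:R)).[(1 + t) / (1 - t)]
    = (bin2_poly A B).[t].
Proof.
move=> t1.
have nt : 1 - t != 0 by rewrite subr_eq0 eq_sym.
have n0 (k : nat) : k`!%:R != 0 :> F by rewrite pnatr_eq0 -lt0n fact_gt0.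
rewrite /bin2_poly horner_sum.
under [RHS]eq_bigr do rewrite hornerZ hornerXn.
rewrite /jacobi hornerZ horner_sum add0r.
have p1 k : pochhammer (1 : F) k = k`!%:R.
  by have := pochhammer_succ F 0 k; rewrite mulr0n add0r add0n binn mul1n.
rewrite p1 divff // mul1r mulr_sumr.
(* Pascal's rule: C(B+n, n+k) is the k-th difference of C(B+n, n), equal to C(B,k) at n = 0. *)
have DS k n : 'C(B + n, n + k.+1)%:R
    = 'C(B + n.+1, n.+1 + k)%:R - 'C(B + n, n + k)%:R :> F.
  by rewrite !addnS addSn binS natrD addrK.
transitivity (\sum_(k < A.+1)
    'C(A, k)%:R * t ^+ k * (1 - t) ^+ (A - k) * ('C(B + k, k)%:R : F)); last first.
  transitivity (\sum_(k < A.+1) 'C(A, k)%:R * t ^+ k * ('C(B + 0, 0 + (0 + k))%:R : F)).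
    rewrite -(bernstein_differences _ (fun k n => 'C(B + n, n + k)%:R) t DS A 0 0).
    by apply: eq_bigr => k _; rewrite add0n addn0.
  by apply: eq_bigr => k _; rewrite !add0n addn0 natrM mulrAC.
apply: eq_bigr => k _; have kA : (k <= A)%N by rewrite -ltnS.
rewrite p1 pochhammer_opp // addr0.
rewrite (_ : A%:R + _ + 1 = B%:R + 1); last by ring.
rewrite pochhammer_succ hornerZ horner_exp hornerZ hornerD hornerN hornerX (hornerC 1).
rewrite (_ : 2%:R^-1 * (1 - (1 + t) / (1 - t)) = - t / (1 - t)); last by field.
have -> : (1 - t) ^+ A = (1 - t) ^+ (A - k) * (1 - t) ^+ k by rewrite -exprD subnK.
(* The sign of (-A)_k cancels that of (-t)^k. *)
have s1 : (-1) ^+ k * (-1) ^+ k = 1 :> F by rewrite -exprMn mulN1r opprK expr1n.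
rewrite !natrM exprMn (exprNn t) exprVn; move: s1 (expf_neq0 k nt) (n0 k).
move: ((1 - t) ^+ k) ((1 - t) ^+ (A - k)) ((-1) ^+ k) (t ^+ k).
move: 'C(A, k)%:R 'C(B + k, k)%:R k`!%:R => p q f a b e u ee an fn.
transitivity (e * e * (p * u * b * q)).
  by field; apply/andP.
by rewrite ee mul1r.
Qed.

(** * Generating functions of binomial products *)

Lemma conv_bin1 (K : comNzRingType) (b n : nat) :
  conv ((1 - 'X) ^+ b.+1) (fun m => 'C(m + b, m)%:R) n = (1 : {poly K})`_n.
Proof.
have E f m : conv (1 - 'X) f m = f m - (if m is k.+1 then f k else 0) :> K.
  by rewrite -['X]mul1r convBl conv1 conv_cX; case: m => // m; rewrite mul1r.
elim: b n => [|b IH] n.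
  rewrite expr1 E coef1; case: n => [|n] /=; first by rewrite bin0 subr0.
  by rewrite !addn0 !binn subrr.
rewrite exprSr convM -IH; apply: eq_conv => m _; rewrite E.
case: m => [|m]; first by rewrite !bin0 subr0.
by rewrite addnS binS natrD addSnnS addrK.
Qed.

(* With theta = t d/dt, the series W_a = sum_m C(m+a,m) C(m+b,m) t^m satisfies
   (a+1) W_(a+1) = (theta + a + 1) W_a; multiplied by (1-t)^(a+b+2) this is the
   recurrence bin2_poly_up. *)
Lemma conv_bin2 (a b n : nat) :
  conv ((1 - 'X) ^+ (a + b).+1) (fun m => ('C(m + a, m) * 'C(m + b, m))%:R) n
    = (bin2_poly a b : {poly int})`_n.
Proof.
elim: a n => [|a IH] n.
  rewrite bin2_poly0 -(conv_bin1 _ b); apply: eq_conv => m _.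
  by rewrite addn0 binn mul1n.
pose W m : int := ('C(m + a, m) * 'C(m + b, m))%:R.
pose D : {poly int} := (1 - 'X) ^+ (a + b).+1.
have a0 : a.+1%:R != 0 :> int by rewrite pnatr_eq0.
apply: (mulfI a0); rewrite -convZr -coefZ bin2_poly_up.
transitivity (conv ((1 - 'X) * D) (fun m => m%:R * W m + a.+1%:R * W m) n).
  rewrite addSn [X in conv X]exprS; apply: eq_conv => m _.
  have := mul_bin_down (m + a).+1 m; rewrite /= subSn ?leq_addr // addKn => e.
  by rewrite -mulrDl -natrD addnS -!natrM !mulnA -e.
have IHD m : conv D W m = (bin2_poly a b)`_m by exact: IH.
have theta m : conv D (fun k => k%:R * W k) m
    = ('X * (bin2_poly a b)^`())`_m - conv ('X * D^`()) W m.
  rewrite coefXM coef_deriv -[LHS](addKr (conv ('X * D^`()) W m)) -conv_theta IHD addrC.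
  by case: m => [|m] /=; rewrite ?mul0r // mulr_natl.
(* The extra factor 1 - t makes theta(D) a polynomial multiple of D. *)
have XD : (1 - 'X) * ('X * D^`()) = - ((a + b).+1%:R *: 'X) * D.
  rewrite deriv_exp derivB derivC derivX sub0r /D exprS -mulr_natl -mul_polyC.
  by rewrite rmorph_nat /=; ring.
transitivity (conv (1 - 'X)
      (fun m => ('X * (bin2_poly a b)^`() + a.+1%:R *: bin2_poly a b)`_m) n
    - conv (1 - 'X) (conv ('X * D^`()) W) n).
  rewrite convM -[in RHS]convBr; apply: eq_conv => m _.
  by rewrite convD convZr theta IHD coefD coefZ addrAC.
have -> : conv (1 - 'X) (conv ('X * D^`()) W) n = (- ((a + b).+1%:R *: 'X) * bin2_poly a b)`_n.
  by rewrite -convM XD convM -conv_coef; apply: eq_conv => m _; exact: IHD.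
rewrite conv_coef -coefB.
apply: (congr1 (fun p : {poly int} => p`_n)).
by rewrite -!mul_polyC !rmorph_nat -addnS natrD; ring.
Qed.

(** * Counting multichains in the trapezoid *)

(* phi m a b is the number of multichains of length m above (i, c) in T_{r,s},
   where a = i - 1 and b = s - c - 1; psi sums it over c, and Phi sums psi
   over i. *)
Definition psi (m a b : nat) : int :=
  'C(m + a, m)%:R * 'C(m + b, m.+1)%:R - 'C(m + b, m)%:R * 'C(m + a, m.+1)%:R.

Definition phi (m a b : nat) : int := psi m a b.+1 - psi m a b.

Definition Phi (m a b : nat) : int :=
  'C(m + a, m.+1)%:R * 'C(m + b, m.+1)%:R - 'C(m + b, m)%:R * 'C(m + a, m.+2)%:R.

Lemma phi0 a b : phi 0 a b = 1.
Proof. rewrite /phi /psi !add0n !bin0 !bin1 -addn1 natrD; ring. Qed.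

Lemma phiS m a b : phi m.+1 a b = Phi m a.+1 b.+1.
Proof. rewrite /phi /psi /Phi !addnS !addSn !binS !natrD; ring. Qed.

Lemma Phi0 m b : Phi m 0 b = 0.
Proof.
by rewrite /Phi addn0 (@bin_small m m.+1) // (@bin_small m m.+2) // mul0r mulr0 subr0.
Qed.

Lemma PhiS m a b : Phi m a.+1 b - Phi m a b = psi m a b.
Proof. rewrite /Phi /psi !addnS !binS !natrD; ring. Qed.

(** Boundary value at the edge c = s - i, where the telescoping over c ends. *)
Lemma psi_diag m a : psi m a a = 0.
Proof. by rewrite /psi mulrC subrr. Qed.

Lemma trap_sum (r s i0 c0 : nat) (F : nat -> nat -> int) : (i0 <= r)%N ->
  \sum_(y : trap r s | (trap_i y <= i0)%N && (c0 <= trap_c y)%N) F (trap_i y) (trap_c y)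
    = \sum_(1 <= j < i0.+1) \sum_(maxn c0 j <= e < (s - j).+1) F j e.
Proof.
move=> i0r; pose A (p : 'I_r.+1 * 'I_s.+1) := (1 <= p.1)%N && (p.1 <= p.2 <= s - p.1)%N.
pose Q (p : 'I_r.+1 * 'I_s.+1) := (p.1 <= i0)%N && (c0 <= p.2)%N.
rewrite -[LHS](big_sub_cond A Q (fun p => F p.1 p.2)).
transitivity (\sum_(j < r.+1 | (1 <= j)%N && (j <= i0)%N)
    \sum_(e < s.+1 | (maxn c0 j <= e)%N && (e < (s - j).+1)%N) F j e).
  rewrite pair_big_dep; apply: eq_bigl => -[j e] /=.
  by rewrite /in_mem /= /A /Q /=; lia.
rewrite [RHS]big_geq_mkord [RHS](big_ord_widen_cond r.+1 (fun j => true && (0 < j)%N)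
  (fun j => \sum_(maxn c0 j <= e < (s - j).+1) F j e)) ?ltnS //.
apply: eq_big => // j _.
rewrite [RHS]big_geq_mkord [RHS](big_ord_widen_cond s.+1
  (fun e => true && (maxn c0 j <= e)%N) (F j)) ?ltnS ?leq_subr //.
Qed.

Lemma sum_phi (m s j lo : nat) : (j < lo)%N -> (lo <= s - j)%N ->
  \sum_(lo <= e < (s - j.+1).+1) phi m j (s - e.+1) = psi m j (s - lo).
Proof.
move=> jlo los; have [lo1|lo1] := leqP lo (s - j.+1).+1; last first.
  by rewrite big_geq ?(ltnW lo1) // (_ : s - lo = j)%N ?psi_diag //; lia.
rewrite (telescope_sumr_eq (fun e => - psi m j (s - e))) // => [|e /andP[_ el]].
  by rewrite opprK (_ : s - (s - j.+1).+1 = j)%N ?psi_diag ?oppr0 ?add0r //; lia.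
by rewrite /phi (_ : (s - e.+1).+1 = s - e)%N; [ring | lia].
Qed.

(** Elements above (i, c) are the (j, e) with j <= i and e >= c, since c >= i >= j. Summing over e
    telescopes to psi, then over j to Phi, which [phiS] identifies with the next phi. *)
Lemma trap_chain_sum (r s m : nat) (x : trap r s) :
  chain_sum (fun _ => 1 : int) m x = phi m (trap_i x).-1 (s - (trap_c x).+1).
Proof.
elim: m x => [|m IH] x /=; first by rewrite phi0.
have [i1 ir ic cs] := trapP x.
rewrite mul1r phiS (eq_bigr _ (fun y _ => IH y)).
under eq_bigl do rewrite trap_leE.
rewrite (trap_sum r s (trap_i x) (trap_c x) (fun j e => phi m j.-1 (s - e.+1))) //.
rewrite big_add1 /= prednK // (_ : (s - (trap_c x).+1).+1 = s - trap_c x)%N; last by lia.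
rewrite (telescope_sumr_eq (fun j => Phi m j (s - trap_c x))) // ?Phi0 ?subr0 // => j ji.
rewrite PhiS (maxn_idPl _); last by lia.
by rewrite sum_phi //; lia.
Qed.

(* Proctor: multichains in the trapezoid are equinumerous with those in the
   product of chains with r and s - r elements. *)
Lemma trap_multichains (r s m : nat) : (1 <= r)%N -> (2 * r <= s)%N ->
  \sum_(x : trap r s) chain_sum (fun _ => 1 : int) m x
    = ('C(m.+1 + (r - 1), m.+1) * 'C(m.+1 + (s - r - 1), m.+1))%:R.
Proof.
move=> r1 rs; rewrite (eq_bigr _ (fun y _ => trap_chain_sum r s m y)).
rewrite (eq_bigl (fun y => (trap_i y <= r)%N && (0 <= trap_c y)%N)); last first.
  by move=> y; have [_ -> _ _] := trapP y.
rewrite (trap_sum r s r 0 (fun j e => phi m j.-1 (s - e.+1))) //.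
rewrite big_add1 /=.
(* The row i = j + 1 contributes psi m j (s - j - 1), the increment of this product; the product
   vanishes at j = 0. *)
rewrite (telescope_sumr_eq (fun j => 'C(j + m, m.+1)%:R * 'C(s - j + m, m.+1)%:R)) //.
  rewrite add0n (@bin_small m) // mul0r subr0 -natrM; congr ('C(_, _) * 'C(_, _))%:R; lia.
move=> j jr; rewrite max0n sum_phi ?ltnSn //; last by lia.
rewrite (_ : s - j = (s - j.+1).+1)%N; last by lia.
rewrite /psi !addSn !binS !natrD ![(_ + m)%N]addnC; ring.
Qed.

(** * Specialization at q = 1 and conclusion *)

Lemma trap_rank_lt (r s : nat) (x y : trap r s) :
  (x < y)%O -> (trap_rank x < trap_rank y)%N.
Proof.
have [x1 x2 x3 x4] := trapP x; have [y1 y2 y3 y4] := trapP y.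
by rewrite trap_ltE trap_leE /trap_rank; lia.
Qed.

Lemma trap_max_rank (r s : nat) : (1 <= r)%N -> (2 * r <= s)%N ->
  (\max_(x : trap r s) trap_rank x = s - 2)%N.
Proof.
move=> r1 rs; apply/eqP; rewrite eqn_leq; apply/andP; split.
  by apply/bigmax_leqP => x _; have [x1 x2 x3 x4] := trapP x; rewrite /trap_rank; lia.
have [||x [xi xc]] := @trap_mk r s 1 s.-1; try lia.
by rewrite (leq_trans _ (leq_bigmax x)) // /trap_rank xi xc; lia.
Qed.

Lemma map_qzeta_den (H : nat) :
  map_poly (horner_eval 1) (qzeta_den H) = (1 - 'X) ^+ H.+1.
Proof.
rewrite /qzeta_den rmorph_prod; under eq_bigr => a _.
  rewrite rmorphB rmorph1 rmorphM /= map_polyC map_polyX /= /horner_eval.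
  rewrite hornerXn expr1n mul1r; over.
by rewrite prodr_const card_ord.
Qed.

Lemma qzeta_coef_trap1 (r s m : nat) : (1 <= r)%N -> (2 * r <= s)%N ->
  (qzeta_coef (@trap_rank r s) m).[1]
    = ('C(m + (r - 1), m) * 'C(m + (s - r - 1), m))%:R.
Proof.
move=> r1 rs; case: m => [|m]; first by rewrite qzeta_coef0 (hornerC 1) !bin0.
rewrite -trap_multichains // qzeta_coefS horner_sum; apply: eq_bigr => x _.
rewrite -[LHS]/(horner_eval 1 _) chain_sum_rmorph; elim: m x => [|m IH] x /=.
  by rewrite /horner_eval hornerXn expr1n.
rewrite /horner_eval hornerXn expr1n; congr (_ * _).
by apply: eq_bigr => y _; exact: IH.
Qed.

Lemma trap_numerator_at1 (r s : nat) (N : {poly {poly int}}) :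
  (1 <= r)%N -> (2 * r <= s)%N -> is_qzeta_numerator (@trap_rank r s) N ->
  map_poly (horner_eval 1) N = bin2_poly (r - 1) (s - r - 1).
Proof.
move=> r1 rs NE; apply/polyP => n; rewrite -conv_bin2 coef_map /= -NE.
(* Since A + B = s - 2 = H, the denominator at q = 1 is exactly (1 - t)^(A+B+1). *)
rewrite trap_max_rank // /horner_eval horner_sum (_ : (_ + _).+1 = (s - 2).+1); last by lia.
rewrite -map_qzeta_den; apply: eq_bigr => k _.
by rewrite coef_map hornerM qzeta_coef_trap1.
Qed.

Theorem corollary4p8 (R : realType) (r s : nat)
    (hr : (1 <= r)%N) (hs : (2 * r <= s)%N) :
  exists N : {poly {poly int}},
    unique (is_qzeta_numerator (@trap_rank r s)) N /\
    let A := (r - 1)%N in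
    let B := (s - r - 1)%N in
    let h : {poly int} := map_poly (horner_eval 1) N in
    let hR : {poly R} := map_poly intr h in
    let hC : {poly R[i]} := map_poly intr h in
    [/\ h = \sum_(k < r) ('C(r - 1, k) * 'C(s - r - 1, k))%:R *: 'X^k,
        (forall z : R[i], root hC z ->
           exists x : R, [/\ z = x%:C, x < 0 & mup z hC = 1%N])
      & (forall t : R, t != 1 ->
           hR.[t] = (1 - t) ^+ A
                    * (jacobi A 0 (B%:R - A%:R)).[(1 + t) / (1 - t)])].
Proof.
have [N NE] := qzeta_numerator_exists _ (@trap_rank_lt r s).
exists N; split.
  by split=> // N' NE'; apply/polyP => n; rewrite -NE -NE'.
move=> A B h hR hC.
have hE : h = bin2_poly A B by exact: trap_numerator_at1.
have hRE : hR = bin2_poly A B by rewrite /hR hE map_bin2_poly.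
have hCE : hC = bin2_poly A B by rewrite /hC hE map_bin2_poly.
have rA : r = A.+1 by rewrite /A; lia.
split.
- by rewrite hE /bin2_poly -rA.
- by rewrite hCE => z; apply: bin2_poly_complex_root; rewrite /A /B; lia.
by move=> t t1; rewrite hRE jacobi_bin2_poly.
Qed.
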